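(* For each $n$ let $X_n$ be a random variable with law $\mathbf q_n$. Then, as $n\to\infty$, $$\frac{X_n-\frac12\log n}{\sqrt{\frac12\log n}}\longrightarrow \mathcal N(0,1)\quad\text{in distribution},$$ where $\mathcal N(0,1)$ is the centered Gaussian distribution with unit variance.
   Context: $\mathbf q_n=(q_n(k))_{0\le k\le n}$, $n\ge0$, are the probability distributions determined by $q_0(0)=1$, $q_1(1)=1$, $q_1(0)=0$ and, for $N\ge2$ and $0\le k\le N$, $$q_N(k)=\tfrac1N\,q_{N-1}(k-1)+\left(1-\tfrac1N\right)q_{N-2}(k),$$ with $q_n(-1)=0$ and $q_n(k)=0$ if $k>n\ge0$. *)

(* Defs.v *)
From HB Require Import structures.
From mathcomp Require Import all_boot all_order all_algebra.
From mathcomp Require Import all_classical all_reals all_analysis.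
From mathcomp Require Import measurable_realfun.
Import Order.TTheory GRing.Theory Num.Theory.
Import numFieldNormedType.Exports.

Set Implicit Arguments.
Unset Strict Implicit.
Unset Printing Implicit Defensive.

Local Open Scope classical_set_scope.
Local Open Scope ring_scope.

(* The convention [q_n(-1) = 0] is the [else] branch; [q_n(k) = 0] for [k > n]
   is not imposed but follows, see [qE_gt]. *)
Fixpoint q (R : realType) (n k : nat) {struct n} : R :=
  match n with
  | 0 => (k == 0%N)%:R
  | 1 => (k == 1%N)%:R
  | (m.+1 as m1).+1 =>
      n%:R^-1 * (if k is j.+1 then q R m1 j else 0) + (1 - n%:R^-1) * q R m k
  end.

Lemma q_ind2 (Q : nat -> Prop) :
  Q 0 -> Q 1 -> (forall n, Q n -> Q n.+1 -> Q n.+2) -> forall n, Q n.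
Proof.
move=> Q0 Q1 QS n; suff [] : Q n /\ Q n.+1 by [].
by elim: n => [//|n [Qn QSn]]; split=> //; exact: QS.
Qed.

Lemma qSS (R : realType) n k :
  q R n.+2 k = n.+2%:R^-1 * (if k is j.+1 then q R n.+1 j else 0)
               + (1 - n.+2%:R^-1) * q R n k.
Proof. by []. Qed.

Lemma qE_gt (R : realType) n k : (n < k)%N -> q R n k = 0.
Proof.
elim/q_ind2: n k => [[]//|[|[]]//|n IH0 IH1 [//|k] nk].
by rewrite qSS IH1// IH0 ?mulr0 ?addr0// (ltn_trans _ nk).
Qed.

Lemma q_ge0 (R : realType) n k : 0 <= q R n k.
Proof.
elim/q_ind2: n k => [k|k|n IH0 IH1 k]; [exact: ler0n|exact: ler0n|].
rewrite qSS addr_ge0// mulr_ge0//; first by case: k.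
by rewrite subr_ge0 invf_le1// ler1n.
Qed.

Lemma q_sum (R : realType) n : \sum_(k < n.+1) q R n k = 1.
Proof.
elim/q_ind2: n => [||n IH0 IH1].
- by rewrite big_ord1.
- by rewrite big_ord_recl big_ord1 add0r.
under eq_bigr do rewrite qSS.
rewrite big_split/= -!mulr_sumr big_ord_recl add0r.
rewrite (eq_bigr (fun i : 'I_n.+2 => q R n.+1 i))// IH1 !big_ord_recr/= [q R n n.+2]qE_gt// [q R n n.+1]qE_gt// !addr0.
by move: IH0; rewrite big_ord_recr/= => ->; rewrite !mulr1 addrC subrK.
Qed.

Definition standardize d (T : measurableType d) (R : realType)
    (X : {mfun T >-> R}) (m s : R) : T -> R :=
  fun w => (X w - m) / s.

Section standardize_measurable.
Context d (T : measurableType d) (R : realType).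
Variables (X : {mfun T >-> R}) (m s : R).

Let measurable_standardize : measurable_fun setT (standardize X m s).
Proof. by apply: measurable_funM => //; exact: measurable_funB. Qed.

HB.instance Definition _ := isMeasurableFun.Build _ _ _ _ (standardize X m s)
  measurable_standardize.

End standardize_measurable.

(* Convergence of the distribution functions at every continuity point of the
   limiting one; the [Y n] may live on different probability spaces. *)
Definition cvg_in_distribution (R : realType) (d : nat -> measure_display)
    (T : forall n, measurableType (d n)) (P : forall n, probability (T n) R)
    (Y : forall n, {RV (P n) >-> R})
    (nu : probability (measurableTypeR R) R) : Prop :=
  forall x : R, {for x, continuous (fun y : R => nu `]-oo, y]%classic)} ->
    cdf (Y n) x @[n --> \oo] --> nu `]-oo, x]%classic.

(* Main.v *)
Require Import Defs.
From HB Require Import structures.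
From mathcomp Require Import all_boot all_order all_algebra.
From mathcomp Require Import all_classical all_reals all_analysis.
From mathcomp Require Import measurable_realfun.
From mathcomp Require Import ring lra zify.
Import Order.TTheory GRing.Theory Num.Theory.
Import numFieldNormedType.Exports.

Local Open Scope classical_set_scope.
Local Open Scope ring_scope.

(* Let [Y_n] be a sum of independent Bernoulli variables of parameters 1/2, 1/4,
   ..., 1/(2n).  Its law satisfies the recursion of [q] up to a second
   difference with coefficient 1/(4 N (N - 1)), which is summable in [N]; as the
   recursion is an average, the expectations of a 1-Lipschitz function under
   [q_n] and under [Y_n] differ by at most 2, so they agree asymptotically at
   the scale sqrt(log n).  For [Y_n], the sum of the squared parameters is
   bounded, so [Y_n] almost satisfies the Poisson identity
   E[Y g(Y)] = E[Y] E[g(Y + 1)], which at the scale sqrt(log n) becomes the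
   Gaussian one E[W f(W)] = E[f'(W)].  Solving Stein's equation
   f'(w) - w f(w) = max(b - w, 0) - E[max(b - Z, 0)] with Z Gaussian gives the
   convergence of the expectations of w |-> max(b - w, 0), hence that of the
   distribution functions, since the indicator of ]-oo, x] is squeezed between
   difference quotients in b of these functions. *)

(** * Comparison with a sum of independent Bernoulli variables *)

Definition qsum (R : realType) (n : nat) (g : nat -> R) : R :=
  \sum_(k < n.+1) q R n k * g k.

Lemma qsumSS (R : realType) n (g : nat -> R) :
  qsum R n.+2 g = n.+2%:R^-1 * qsum R n.+1 (g \o S)
                  + (1 - n.+2%:R^-1) * qsum R n g.
Proof.
rewrite /qsum; under eq_bigr do rewrite qSS mulrDl.
rewrite big_split/= big_ord_recl mulr0 mul0r add0r !mulr_sumr; congr (_ + _).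
  by apply: eq_bigr => i _; rewrite mulrA.
rewrite 2!big_ord_recr/= !qE_gt// !mulr0 !mul0r !addr0.
by apply: eq_bigr => i _; rewrite mulrA.
Qed.

Lemma ler_qsum (R : realType) n (f g : nat -> R) :
  (forall k, f k <= g k) -> qsum R n f <= qsum R n g.
Proof. by move=> fg; apply: ler_sum => i _; rewrite ler_wpM2l ?q_ge0. Qed.

Lemma qsum_lin (R : realType) n (a c : R) (f g : nat -> R) :
  qsum R n (fun k => a * f k + c * g k) = a * qsum R n f + c * qsum R n g.
Proof.
by rewrite /qsum !mulr_sumr -big_split/=; apply: eq_bigr => i _; ring.
Qed.

(* [bsum n g] is the expectation of [g] at a sum of independent Bernoulli
   variables of parameters 1/2, 1/4, ..., 1/(2n). *)
Fixpoint bsum (R : realType) (n : nat) (g : nat -> R) : R :=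
  if n is m.+1 then bsum R m (fun k => g k + (2 * n%:R)^-1 * (g k.+1 - g k))
  else g 0%N.

Lemma bsumS (R : realType) n (g : nat -> R) :
  bsum R n.+1 g = bsum R n (fun k => g k + (2 * n.+1%:R)^-1 * (g k.+1 - g k)).
Proof. by []. Qed.

Lemma bsum_lin (R : realType) n (a c : R) (f g : nat -> R) :
  bsum R n (fun k => a * f k + c * g k) = a * bsum R n f + c * bsum R n g.
Proof.
elim: n f g => [//|n IH] f g /=; rewrite -IH; congr (bsum R n _).
by apply/funext => k; ring.
Qed.

Lemma bsumZ (R : realType) n (a : R) (f : nat -> R) :
  bsum R n (fun k => a * f k) = a * bsum R n f.
Proof.
rewrite -[RHS]addr0 -[0](mul0r (bsum R n f)) -bsum_lin.
by congr (bsum R n _); apply/funext => k; ring.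
Qed.

Lemma bsumB (R : realType) n (f g : nat -> R) :
  bsum R n (fun k => f k - g k) = bsum R n f - bsum R n g.
Proof.
rewrite -[bsum R n f]mul1r -mulN1r -bsum_lin.
by congr (bsum R n _); apply/funext => k; ring.
Qed.

Lemma bsum_cst (R : realType) n (a : R) : bsum R n (fun=> a) = a.
Proof.
elim: n => [//|n IH] /=; rewrite -[RHS]IH; congr (bsum R n _).
by apply/funext => k; ring.
Qed.

(** This is a convex combination of [x] and [y]: the weight of [y] lies between 0 and 1. *)
Lemma ler_norm_mix (R : realType) n (x y M : R) :
  `|x| <= M -> `|y| <= M -> `|x + (2 * n.+1%:R)^-1 * (y - x)| <= M.
Proof.
move=> xM yM.
have p0 : 0 <= (2 * n.+1%:R)^-1 :> R by rewrite invr_ge0 mulr_ge0.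
have p1 : (2 * n.+1%:R)^-1 <= 1 :> R.
  by rewrite invf_le1 ?mulr_gt0// -natrM ler1n.
move: (2 * _)^-1 p0 p1 => p p0 p1.
have -> : x + p * (y - x) = (1 - p) * x + p * y by ring.
rewrite -subr_ge0 in p1.
apply: (le_trans (ler_normD _ _)); rewrite !normrM (ger0_norm p0) (ger0_norm p1).
have := ler_wpM2l p1 xM; have := ler_wpM2l p0 yM; lra.
Qed.

Lemma bsum_bound (R : realType) n (g : nat -> R) (M : R) :
  (forall k, `|g k| <= M) -> `|bsum R n g| <= M.
Proof.
elim: n g => [|n IH] g gM /=; first exact: gM.
by apply: IH => k; exact: ler_norm_mix.
Qed.

(** With D the forward difference, the i-th Bernoulli variable acts on functions as I + D/(2i). For
    N = n + 2, both sides have first-order coefficient (2N - 1)/(2N(N - 1)). The D^2 coefficients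
    are 1/(4N(N - 1)) for the product and 1/(2N(N - 1)) for the average, hence the correction. *)
Lemma bsumSS (R : realType) n (g : nat -> R) :
  bsum R n.+2 g = n.+2%:R^-1 * bsum R n.+1 (g \o S)
    + (1 - n.+2%:R^-1) * bsum R n g
    - (4 * n.+1%:R * n.+2%:R)^-1
      * bsum R n (fun k => (g k.+2 - g k.+1) - (g k.+1 - g k)).
Proof.
rewrite !bsumS -!bsum_lin -bsumZ -bsumB; congr (bsum R n _).
apply/funext => k /=.
by rewrite -[n.+2%:R]natr1; field; rewrite (addrC 1) !natr1 !pnatr_eq0.
Qed.

Lemma qsum_bsum (R : realType) n (g : nat -> R) (M : R) :
  (forall k, `|g k.+1 - g k| <= M) -> `|qsum R n g - bsum R n g| <= 2 * M.
Proof.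
move=> gM; have M0 : 0 <= M by exact: le_trans (gM 0%N).
(* The strengthened bound grows with [n], so that its increments can pay for the second-difference
   terms of [bsumSS]. *)
suff : `|qsum R n g - bsum R n g| <= (2 - 2 * n.+1%:R^-1) * M.
  move/le_trans; apply; rewrite ler_wpM2r// gerBl mulr_ge0//.
elim/q_ind2: n g gM => [g gM|g gM|n IH0 IH1 g gM].
- by rewrite /qsum big_ord1/= mul1r subrr normr0 mulr_ge0// invr1; lra.
- rewrite /qsum 2!big_ord_recr big_ord0/= mul0r mul1r !add0r mulr1.
  have -> : g 1%N - (g 0%N + 2^-1 * (g 1%N - g 0%N)) = 2^-1 * (g 1%N - g 0%N).
    by field.
  rewrite normrM ger0_norm; last by rewrite invr_ge0.
  have -> : 2 - 2 * 2^-1 = 1 :> R by lra.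
  by apply: ler_pM => //; lra.
rewrite qsumSS bsumSS.
set D := bsum R n (fun k => _ - _).
have DM : `|D| <= 2 * M.
  apply: bsum_bound => k; apply: (le_trans (ler_normB _ _)).
  by rewrite mulr2n mulrDl mul1r lerD.
have e0M := IH0 g gM; have e1M := IH1 (g \o S) (fun k => gM k.+1).
set c : R := n.+1%:R^-1 in e0M *; set a : R := n.+2%:R^-1 in e1M *.
set b : R := n.+3%:R^-1.
have c0 : 0 < c by rewrite invr_gt0.
have ca : c - a = c * a.
  by rewrite /a /c -[n.+2%:R]natr1; field; rewrite (addrC 1) !natr1 !pnatr_eq0.
have ab : a - b = a * b.
  by rewrite /a /b -[n.+3%:R]natr1; field; rewrite -[1]/(1%:R) -!natrD !pnatr_eq0.
(* From n + 1 to n + 2 the bound grows by 2abM. This covers the new error (ca/4)(2M) precisely when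
   c <= 4b. *)
have c4b : c <= 4 * b.
  rewrite /c /b -[4]invrK -invfM lef_pV2 ?posrE ?mulr_gt0 ?invr_gt0//.
  by rewrite mulrC ler_pdivrMr// -natrM ler_nat mulnC; lia.
have a0 : 0 < a by rewrite invr_gt0.
have a1 : a <= 1 by rewrite invf_le1// ler1n.
have -> : (4 * n.+1%:R * n.+2%:R)^-1 = c * a / 4 by rewrite !invfM -mulrA mulrC.
have -> : a * qsum R n.+1 (g \o S) + (1 - a) * qsum R n g
    - (a * bsum R n.+1 (g \o S) + (1 - a) * bsum R n g - c * a / 4 * D)
  = a * (qsum R n.+1 (g \o S) - bsum R n.+1 (g \o S))
    + (1 - a) * (qsum R n g - bsum R n g) + c * a / 4 * D by ring.
apply: (le_trans (ler_normD _ _)).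
apply: (le_trans (lerD (ler_normD _ _) (lexx _))).
have ca0 : 0 <= c * a / 4 by rewrite divr_ge0// mulr_ge0// ltW.
rewrite -subr_ge0 in a1.
rewrite !normrM !(ger0_norm (ltW a0)) (ger0_norm a1) (ger0_norm (ltW c0)) normfV.
rewrite (ger0_norm (ler0n _ 4)).
have h1 := ler_wpM2l (ltW a0) e1M; have h0 := ler_wpM2l a1 e0M.
have h2 := ler_wpM2l ca0 DM.
have h3 : 0 <= (1 - a) * (c * a) * M by rewrite !mulr_ge0// ltW.
have h4 : 0 <= a * (4 * b - c) * M by rewrite !mulr_ge0// ?subr_ge0// ltW.
have -> : 2 - 2 * b = 2 - 2 * a + 2 * (a * b) by rewrite -ab; ring.
have e : 2 - 2 * c = 2 - 2 * a - 2 * (c * a) by rewrite -ca; ring.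
by rewrite e in h0; lra.
Qed.

(** * Approximate Poisson and Gaussian identities for the Bernoulli sum *)

Definition bmean (R : realType) (n : nat) : R := \sum_(i < n) (2 * i.+1%:R)^-1.

(** Adding a Bernoulli variable of parameter p replaces [g] by its average [G] in the defect, and
    subtracts p^2 times the expectation of a first difference of [g]. The defect is thus at most M
    times the sum of the squared parameters, controlled by the telescoping bound p^2 <= 1/(n+1) -
    1/(n+2). *)
Lemma bsum_stein (R : realType) n (g : nat -> R) (M : R) :
  (forall k, `|g k.+1 - g k| <= M) ->
  `|bsum R n (fun k => k%:R * g k) - bmean R n * bsum R n (g \o S)| <= M.
Proof.
move=> gM; have M0 : 0 <= M by exact: le_trans (gM 0%N).
suff : `|bsum R n (fun k => k%:R * g k) - bmean R n * bsum R n (g \o S)|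
    <= (1 - n.+1%:R^-1) * M.
  by move/le_trans; apply; rewrite ler_piMl// gerBl.
elim: n g gM => [g gM|n IH g gM].
  by rewrite /bmean big_ord0/= !mul0r subr0 normr0 invr1 subrr mul0r.
rewrite /bmean big_ord_recr/= -/(bmean R n).
set p : R := (2 * n.+1%:R)^-1.
pose G k := g k + p * (g k.+1 - g k).
have GM k : `|G k.+1 - G k| <= M.
  rewrite /G.
  have -> : g k.+1 + p * (g k.+2 - g k.+1) - (g k + p * (g k.+1 - g k)) =
    (g k.+1 - g k) + p * ((g k.+2 - g k.+1) - (g k.+1 - g k)) by ring.
  exact: ler_norm_mix.
have -> : bsum R n (fun k => k%:R * g k + p * (k.+1%:R * g k.+1 - k%:R * g k))
   = bsum R n (fun k => k%:R * G k) + p * bsum R n (g \o S).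
  rewrite -[X in X + _]mul1r -bsum_lin; congr (bsum R n _); apply/funext => k.
  by rewrite /G/= -natr1; ring.
have -> : bsum R n (fun k => g k.+1 + p * (g k.+2 - g k.+1)) = bsum R n (G \o S).
  by [].
have -> : bsum R n (fun k => k%:R * G k) + p * bsum R n (g \o succn)
    - (bmean R n + p) * bsum R n (G \o succn)
  = (bsum R n (fun k => k%:R * G k) - bmean R n * bsum R n (G \o succn))
    - p ^+ 2 * bsum R n (fun k => g k.+2 - g k.+1).
  have -> : p ^+ 2 * bsum R n (fun k => g k.+2 - g k.+1)
    = p * (bsum R n (G \o S) - bsum R n (g \o S)); last by ring.
  rewrite -bsumB expr2 -mulrA -[in LHS]bsumZ; congr (_ * bsum R n _).
  by apply/funext => k; rewrite /G/=; ring.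
apply: (le_trans (ler_normB _ _)).
apply: (le_trans (lerD (IH G GM) (lexx _))).
have DM := @bsum_bound R n (fun k => g k.+2 - g k.+1) M (fun k => gM k.+1).
rewrite normrM ger0_norm ?sqr_ge0//.
apply: (le_trans (lerD (lexx _) (ler_wpM2l (sqr_ge0 _) DM))).
rewrite -mulrDl ler_wpM2r//.
have t0 : 0 <= n%:R :> R by [].
have : p ^+ 2 <= n.+1%:R^-1 - n.+2%:R^-1.
  rewrite -subr_ge0.
  have -> : n.+1%:R^-1 - n.+2%:R^-1 - p ^+ 2
      = (3 * n%:R + 2) * p ^+ 2 * n.+2%:R^-1.
    rewrite /p -[n.+2%:R]natr1; field.
    by rewrite -[1]/(1%:R) -!natrD !pnatr_eq0.
  by rewrite !mulr_ge0// ?sqr_ge0 ?invr_ge0//; lra.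
by move: (p ^+ 2) (n.+1%:R^-1) (n.+2%:R^-1) => x y z; lra.
Qed.

(** The Poisson identity is applied to f(w)/s at w = (k - m)/s. The error has three sources: L/s
    from the Taylor expansion of [f] with step 1/s, 2C/s from [bsum_stein], and at most C/s from
    replacing the mean by [m]. *)
Lemma bsum_normal_stein (R : realType) n (m s C L : R) (f f' : R -> R) :
  0 < s -> m = s ^+ 2 -> `|bmean R n - m| <= 2^-1 ->
  (forall w, `|f w| <= C) ->
  (forall w e, 0 < e -> `|f (w + e) - f w - e * f' w| <= L * e ^+ 2) ->
  `|bsum R n (fun k => f' ((k%:R - m) / s)
               - (k%:R - m) / s * f ((k%:R - m) / s))| <= (L + 3 * C) / s.
Proof.
move=> s0 ms nm fC fL; have sn0 : s != 0 by rewrite gt_eqF.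
pose w (k : nat) := (k%:R - m) / s.
have wS k : w k.+1 = w k + s^-1 by rewrite /w -natr1; field.
pose g (k : nat) := f (w k) / s.
have gC k : `|g k| <= C / s.
  by rewrite normrM normfV (gtr0_norm s0) ler_wpM2r// invr_ge0 ltW.
have := @bsum_stein R n g (2 * (C / s)) _.
(* Since k = sw + m and m = s^2, k g(k) - m g(k+1) equals w f(w) - s (f(w + 1/s) - f(w)). *)
have -> : (fun k => f' ((k%:R - m) / s) - (k%:R - m) / s * f ((k%:R - m) / s))
    = fun k => (f' (w k) - s * (f (w k + s^-1) - f (w k)))
        - ((k%:R * g k) - m * g k.+1).
  apply/funext => k; rewrite -/(w k) -wS /g ms.
  have -> : k%:R = s * w k + m by rewrite /w; field.
  by rewrite ms; field.
rewrite bsumB (_ : bsum R n (fun k => _ - m * _) =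
  bsum R n (fun k => k%:R * g k) - m * bsum R n (g \o S)); last first.
  by rewrite -bsumZ -bsumB.
set A := bsum R n (fun k => k%:R * g k).
set B := bsum R n (g \o S).
have BC : `|B| <= C / s by apply: bsum_bound => k; exact: gC.
set D := bsum R n _.
have DL : `|D| <= L / s.
  apply: bsum_bound => k.
  have -> : f' (w k) - s * (f (w k + s^-1) - f (w k))
      = - (s * (f (w k + s^-1) - f (w k) - s^-1 * f' (w k))) by field.
  rewrite normrN normrM (gtr0_norm s0).
  have /(ler_wpM2l (ltW s0)) := fL (w k) s^-1 ltac:(by rewrite invr_gt0).
  by move/le_trans; apply; rewrite le_eqVlt; apply/orP; left; apply/eqP; field.
move=> /(_ (fun k => _)) AB.
have {}AB : `|A - bmean R n * B| <= 2 * (C / s).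
  apply: AB => k; apply: (le_trans (ler_normB _ _)).
  by have := gC k; have := gC k.+1; lra.
have -> : D - (A - m * B) = D - (A - bmean R n * B) - (bmean R n - m) * B by ring.
apply: (le_trans (ler_normB _ _)); apply: (le_trans (lerD (ler_normB _ _) (lexx _))).
have : `|(bmean R n - m) * B| <= C / s.
  by rewrite normrM -[leRHS]mul1r; apply: ler_pM => //; lra.
have -> : (L + 3 * C) / s = L / s + 3 * (C / s) by rewrite mulrDl mulrA.
lra.
Qed.

Lemma ln_succ_bounds (R : realType) n : (0 < n)%N ->
  n.+1%:R^-1 <= ln (n.+1%:R : R) - ln n%:R <= n%:R^-1.
Proof.
move=> n0; have n1 : 0 < n%:R :> R by rewrite ltr0n.
have n2 : 0 < n.+1%:R :> R by rewrite ltr0n.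
apply/andP; split.
  rewrite -opprB -ln_div ?posrE// lerNr.
  have -> : n%:R / n.+1%:R = 1 + - n.+1%:R^-1 :> R.
    by rewrite -(@natr1 _ n); field; rewrite natr1 gt_eqF.
  by apply: le_ln1Dx; rewrite ltrN2 invf_lt1// ltr1n.
rewrite -ln_div ?posrE//.
have -> : n.+1%:R / n%:R = 1 + n%:R^-1 :> R.
  by rewrite -(@natr1 _ n); field; rewrite gt_eqF.
by apply: le_ln1Dx; rewrite (@lt_trans _ _ 0)// invr_gt0.
Qed.

(** [bmean R n] is half the harmonic number H_n, and ln(n+1) <= H_n <= 1 + ln n. *)
Lemma bmean_ln (R : realType) n : (0 < n)%N ->
  `|bmean R n - 2^-1 * ln n%:R| <= 2^-1.
Proof.
move=> n0.
suff /andP[l u] : 2^-1 * ln n.+1%:R <= bmean R n <= 2^-1 * ln n%:R + 2^-1.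
  have /andP[+ _] := @ln_succ_bounds R n n0.
  have : 0 <= n.+1%:R^-1 :> R by [].
  by move: (n.+1%:R^-1) => y y0 h; rewrite ler_norml; apply/andP; split; lra.
case: n n0 => // n _; elim: n => [|n /andP[l u]].
  have /andP[_] := @ln_succ_bounds R 1 isT.
  by rewrite /bmean big_ord1 ln1 mulr1 => h; apply/andP; split; lra.
rewrite /bmean big_ord_recr/= -/(bmean R n.+1) invfM.
have /andP[lo _] := @ln_succ_bounds R n.+1 isT.
have /andP[_ up] := @ln_succ_bounds R n.+2 isT.
by move: (n.+2%:R^-1) lo up => y lo up; apply/andP; split; lra.
Qed.

(** * The Gaussian distribution function and Mills' ratio *)

Lemma normal_pdf01E (R : realType) (x : R) :
  normal_pdf 0 1 x = normal_peak 1 * expR (- (x ^+ 2) / 2).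
Proof.
rewrite normal_pdfE ?oner_neq0// /normal_fun subr0 expr1n -[1 *+ 2]/(2%:R).
by [].
Qed.

Lemma normal_pdf01_gt0 (R : realType) (x : R) : 0 < normal_pdf 0 1 x.
Proof. by rewrite normal_pdf01E mulr_gt0 ?expR_gt0 ?normal_peak_gt0 ?oner_neq0. Qed.

Lemma normal_pdf01N (R : realType) (x : R) : normal_pdf 0 1 (- x) = normal_pdf 0 1 x.
Proof. by rewrite !normal_pdf01E sqrrN. Qed.

Lemma is_derive_normal_pdf01 (R : realType) (x : R) :
  is_derive x 1 (normal_pdf 0 1) (- x * normal_pdf 0 1 x).
Proof.
rewrite (_ : normal_pdf 0 1 = fun x => normal_peak 1 * expR (- (x ^+ 2) / 2)); last first.
  by apply/funext => y; exact: normal_pdf01E.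
apply: is_derive_eq.
by rewrite /GRing.scale/=; field.
Qed.

Section normal_cdf.
Context {R : realType}.
Definition normal_cdf (x : R) : R := fine (normal_prob 0 1 `]-oo, x]).

Lemma normal_cdfE x : (normal_cdf x)%:E = normal_prob 0 1 `]-oo, x].
Proof. by rewrite fineK// fin_num_measure. Qed.

Lemma normal_cdf_ge0 x : 0 <= normal_cdf x.
Proof. by rewrite fine_ge0. Qed.

Lemma normal_cdf_le1 x : normal_cdf x <= 1.
Proof. by rewrite -lee_fin normal_cdfE probability_le1. Qed.

Lemma is_derive_normal_cdf (x : R) :
  is_derive x 1 normal_cdf (normal_pdf 0 1 x).
Proof.
have xx1 : x < x + 1 by rewrite ltrDl.
have int : lebesgue_measure.-integrable `]-oo, x + 1] (EFin \o normal_pdf (0:R) 1).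
  by apply: (integrableS _ _ (subsetT _)) => //; exact: integrable_normal_pdf.
have [] := @continuous_FTC1 R (normal_pdf 0 1) -oo%O x (x + 1) xx1 int (ltNyr x).
  by apply: continuous_normal_pdf; rewrite oner_neq0.
move=> d <-; rewrite derive1E; exact: DeriveDef.
Qed.

(** As a random variable under [normal_prob 0 1], the identity has distribution function
    [normal_cdf]; the limits at infinity then follow from those of [cdf]. *)
Let idR : measurableTypeR R -> R := idfun.

#[local] HB.instance Definition _ :=
  @isMeasurableFun.Build _ _ _ _ idR (@measurable_id _ _ setT).

Lemma cvg_normal_cdfNy : normal_cdf x @[x --> -oo] --> (0 : R).
Proof. by have /fine_cvgP[] := cvg_cdfNy0 (idR : {RV (normal_prob 0 1) >-> R}). Qed.

Lemma cvg_normal_cdfy : normal_cdf x @[x --> +oo] --> (1 : R).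
Proof. by have /fine_cvgP[] := cvg_cdfy1 (idR : {RV (normal_prob 0 1) >-> R}). Qed.

(** As the density is even, Phi(y) + Phi(-y) has zero derivative; its constant value is read off at
    +oo. *)
Lemma normal_cdfN x : normal_cdf (- x) = 1 - normal_cdf x.
Proof.
pose H (y : R) := normal_cdf y + normal_cdf (- y).
have H' (y : R) : is_derive y 1 H 0.
  have d1 := is_derive_normal_cdf y; have d2 := is_derive_normal_cdf (- y).
  have d3 : is_derive y 1 (fun z => normal_cdf (- z)) (- normal_pdf 0 1 y).
    rewrite (_ : (fun z => _) = normal_cdf \o -%R)//.
    apply: is_derive_eq.
    by rewrite normal_pdf01N mulrN1.
  by apply: is_derive_eq; rewrite subrr.
have HE y z : H y = H z by exact: is_derive_0_is_cst.
have : H y @[y --> +oo] --> (1 + 0 : R).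
  apply: cvgD; first exact: cvg_normal_cdfy.
  by have /cvgNy_compNP := cvg_normal_cdfNy.
have -> : H = cst (H x) by apply/funext => y; exact: HE.
by move=> /(cvg_unique (@Rhausdorff R) (cvg_cst _)); rewrite /H; lra.
Qed.

End normal_cdf.

Section mills.
Context {R : realType}.
Local Notation phi := (normal_pdf (0:R) 1).
Local Notation Phi := (@normal_cdf R).

Lemma normal_pdf01_le (x y : R) : `|x| <= y -> phi y <= phi x.
Proof.
move=> xy; rewrite !normal_pdf01E ler_wpM2l ?normal_peak_ge0// ler_expR.
by rewrite ler_pM2r// lerN2 -real_normK ?num_real// lerXn2r ?nnegrE// (le_trans _ xy).
Qed.

Lemma normal_pdf01_decay (x : R) : phi x <= normal_peak 1 / (1 + x ^+ 2 / 2).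
Proof.
rewrite normal_pdf01E ler_wpM2l ?normal_peak_ge0// mulNr expRN lef_pV2 ?expR_ge1Dx//.
  by rewrite posrE expR_gt0.
by rewrite posrE ltr_pwDl// divr_ge0// sqr_ge0.
Qed.

Lemma cvg_normal_pdf01Ny : phi x @[x --> -oo] --> (0 : R).
Proof.
apply/cvgrPdist_le => e e0; near=> x.
rewrite sub0r normrN gtr0_norm ?normal_pdf01_gt0//.
apply: (le_trans (normal_pdf01_decay x)).
have p0 : 0 < normal_peak (1:R) by rewrite normal_peak_gt0 ?oner_neq0.
have x1 : x <= -1 by near: x; apply: nbhs_ninfty_le; exact: num_real.
(* With x <= -1 this yields 1 + x^2/2 >= -x/2 >= [normal_peak 1 / e]. *)
have x2 : x <= - (2 * (normal_peak 1 / e)).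
  by near: x; apply: nbhs_ninfty_le; exact: num_real.
have d0 : 0 < 1 + x ^+ 2 / 2 by nra.
rewrite ler_pdivrMr// mulrC -ler_pdivrMr//.
move: (normal_peak 1 / e) x2 => y x2; nra.
Unshelve. all: by end_near. Qed.

(** [D] is nondecreasing below [b], so D(x) >= D(y) >= -E(y) for y < x, and E(y) becomes arbitrarily
    small. Both Mills inequalities reduce to this. *)
Lemma ge0_derive_Ny (D D' E : R -> R) (b : R) :
  (forall x, x < b -> is_derive x 1 D (D' x)) -> (forall x, x < b -> 0 <= D' x) ->
  E x @[x --> -oo] --> (0 : R) -> (forall x, x < b -> - E x <= D x) ->
  forall x, x < b -> 0 <= D x.
Proof.
move=> DD' D'0 E0 ED x xb; apply/ler_addgt0Pl => e e0.
have [y [yx yE]] : exists y, y < x /\ E y <= e.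
  near (-oo : set_system R) => y; exists y; split.
    by near: y; apply: nbhs_ninfty_lt; exact: num_real.
  near: y; move/cvgrPdist_le : E0 => /(_ e e0); apply: filterS => y.
  by rewrite sub0r normrN; apply: le_trans; exact: ler_norm.
have [z||z + Dxy] := @MVT R D D' y x yx.
- by rewrite in_itv/= => /andP[_ zx]; apply: DD'; exact: lt_trans zx xb.
- apply: derivable_within_continuous => z.
  rewrite in_itv/= => /andP[_ zx]; have := DD' z (le_lt_trans zx xb).
  by [].
rewrite in_itv/= => /andP[yz zx].
have := D'0 z (lt_trans zx xb); have := ED y (lt_trans yx xb).
by rewrite -subr_gt0 in yx; move: (D' z) Dxy yx => d; nra.
Unshelve. all: by end_near. Qed.

(** Phi(y) + y phi(y)/(1 + y^2) has derivative 2 phi(y)/(1 + y^2)^2 and is at least -phi(y). *)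
Lemma mills_lower (x : R) : x < 0 -> - (x * phi x) <= (1 + x ^+ 2) * Phi x.
Proof.
move=> x0.
have d0 (y : R) : 0 < 1 + y ^+ 2 by rewrite ltr_pwDl// sqr_ge0.
suff : 0 <= Phi x + x * phi x / (1 + x ^+ 2).
  rewrite -(pmulr_rge0 _ (d0 x)) mulrDr mulrCA divff ?gt_eqF// mulr1; lra.
pose D y := Phi y + y * phi y / (1 + y ^+ 2).
apply: (@ge0_derive_Ny D (fun y => 2 * phi y / (1 + y ^+ 2) ^+ 2) phi 0) x0.
- move=> y _.
  have d1 := is_derive_normal_cdf y; have d2 := is_derive_normal_pdf01 _ y.
  have d3 := gt_eqF (d0 y).
  rewrite /D.
  apply: is_derive_eq.
    by apply: is_deriveD; apply: is_deriveM; apply: is_deriveV; rewrite d3.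
  by rewrite /GRing.scale/=; field; rewrite d3.
- by move=> y _; rewrite divr_ge0 ?sqr_ge0// mulr_ge0// ltW// normal_pdf01_gt0.
- exact: cvg_normal_pdf01Ny.
- move=> y _; rewrite /D.
  have := normal_cdf_ge0 y; suff : - phi y <= y * phi y / (1 + y ^+ 2) by lra.
  rewrite ler_pdivlMr// mulNr mulrC -mulNr ler_pM2r ?normal_pdf01_gt0//; nra.
Qed.

(** On the negative half-line, -Phi(y) - phi(y)/y has derivative phi(y)/y^2 and is at least
    -Phi(y). *)
Lemma mills_upper (x : R) : x < 0 -> - x * Phi x <= phi x.
Proof.
move=> x0.
suff : 0 <= - Phi x - phi x / x.
  rewrite -(@pmulr_rge0 _ (- x)) ?oppr_gt0//.
  have -> : - x * (- Phi x - phi x / x) = x * Phi x + phi x.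
    by field; rewrite lt_eqF.
  lra.
pose D y := - Phi y - phi y / y.
apply: (@ge0_derive_Ny D (fun y => phi y / y ^+ 2) Phi 0) x0.
- move=> y y0.
  have d1 := is_derive_normal_cdf y; have d2 := is_derive_normal_pdf01 _ y.
  have d3 := lt_eqF y0.
  rewrite /D.
  apply: is_derive_eq.
    by apply: is_deriveB; apply: is_deriveM; apply: is_deriveV; rewrite d3.
  by rewrite /GRing.scale/=; field; rewrite d3.
- by move=> y _; rewrite divr_ge0 ?sqr_ge0// ltW// normal_pdf01_gt0.
- exact: cvg_normal_cdfNy.
- move=> y y0; rewrite /D lerDl -mulrN mulr_ge0 ?ltW ?normal_pdf01_gt0//.
  by rewrite oppr_gt0 invr_lt0.
Qed.

End mills.

(** * Stein's equation for hinge functions *)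

Section stein.
Context {R : realType}.
Local Notation phi := (normal_pdf (0:R) 1).
Local Notation Phi := (@normal_cdf R).

(** For w <= -1, [mills_upper] bounds the ratio by 1. For -1 < w <= B, |w| <= B gives phi(w) >=
    phi(B), while Phi(w) <= 1. *)
Lemma mills_bound (B w : R) : w <= B -> 1 <= B ->
  0 <= Phi w / phi w <= 1 + (phi B)^-1.
Proof.
move=> wB B1; have p0 := normal_pdf01_gt0 R w; have pB := normal_pdf01_gt0 R B.
have ipB : 0 < (phi B)^-1 by rewrite invr_gt0.
rewrite divr_ge0 ?normal_cdf_ge0 ?(ltW p0)//=.
have [w1|w1] := leP w (-1).
  rewrite (@le_trans _ _ 1) ?lerDl ?(ltW ipB)// ler_pdivrMr// mul1r.
  by have := mills_upper _ (le_lt_trans w1 (ltrN10 R)); have := normal_cdf_ge0 w; nra.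
rewrite (@le_trans _ _ (phi B)^-1) ?lerDr// -[leRHS]mul1r.
apply: ler_pM; rewrite ?normal_cdf_ge0 ?normal_cdf_le1 ?invr_ge0 ?(ltW p0)//.
rewrite lef_pV2 ?posrE// normal_pdf01_le// ler_norml wB andbT; lra.
Qed.

(** The quantity is the derivative of w Phi(w)/phi(w). For w <= -1 its large terms cancel: the two
    Mills inequalities place it between 0 and 1. For larger w, each term is bounded separately. *)
Lemma mills2_bound (B w : R) : w <= B -> 1 <= B ->
  `|w + (1 + w ^+ 2) * (Phi w / phi w)| <= 1 + B + (1 + B ^+ 2) * (1 + (phi B)^-1).
Proof.
move=> wB B1; have p0 := normal_pdf01_gt0 R w.
have /andP[m0 mB] := mills_bound _ _ wB B1.
have B2 : 0 <= (1 + B ^+ 2) * (1 + (phi B)^-1).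
  by rewrite mulr_ge0 ?addr_ge0 ?sqr_ge0// invr_ge0 normal_pdf_ge0.
have [w1|w1] := leP w (-1).
  have wl : w < 0 by lra.
  have u : - w * (Phi w / phi w) <= 1.
    by rewrite mulrA ler_pdivrMr// mul1r mills_upper.
  have l : - w <= (1 + w ^+ 2) * (Phi w / phi w).
    by rewrite mulrA ler_pdivlMr// mulNr mills_lower.
  move: (Phi w / phi w) m0 mB u l => m m0 mB u l.
  rewrite ger0_norm; last by lra.
  have : m <= 1 by nra.
  have : w ^+ 2 * m <= - w by nra.
  by move: B2; lra.
have wB' : `|w| <= B by rewrite ler_norml wB andbT; lra.
apply: (le_trans (ler_normD _ _)); apply: lerD; first by lra.
rewrite ger0_norm; last by apply: mulr_ge0 m0; rewrite addr_ge0 ?sqr_ge0.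
apply: ler_pM => //; first by rewrite addr_ge0// sqr_ge0.
by rewrite lerD2l -real_normK ?num_real// lerXn2r// nnegrE; lra.
Qed.

(** Freezing [K] beyond [b] creates no corner, because its derivative vanishes there. This gives the
    differentiability of the numerator of [stein_fun]. *)
Lemma is_derive_stop (K dK : R -> R) (b w : R) :
  is_derive b 1 K 0 -> (w < b -> is_derive w 1 K (dK w)) ->
  is_derive w 1 (fun x => K (Num.min x b)) (if w < b then dK w else 0).
Proof.
move=> Kb Kw; have [wb|wb|wb] := ltgtP w b.
- apply: (@near_eq_is_derive _ _ _ K); last exact: Kw.
  near=> x; rewrite min_l//; apply: ltW; near: x.
  exact: lt_nbhsl.
- apply: (@near_eq_is_derive _ _ _ (cst (K b))).
  near=> x; rewrite min_r//; apply: ltW; near: x.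
  exact: lt_nbhsr.
- subst w; move/is_derive1_caratheodory : Kb => [g [gE gc gb]].
  apply/is_derive1_caratheodory.
  exists (fun z => if z < b then g z else 0); split.
  + move=> z; rewrite minxx; have [zb|zb] := ltP z b; first by rewrite gE.
    by rewrite subrr mul0r.
  + rewrite /prop_for /continuous_at ltxx; apply/cvgrPdist_le => e e0.
    have /cvgrPdist_le /(_ e e0) := gc; apply: filterS => z.
    by rewrite gb !sub0r !normrN; case: ifP => // _ _; rewrite normr0 ltW.
  + by rewrite ltxx.
Unshelve. all: by end_near. Qed.

(* The expectation of [max (b - Z) 0] for a standard Gaussian variable [Z]. *)
Definition gmean (b : R) : R := b * Phi b + phi b.

Lemma is_derive_gmean (b : R) : is_derive b 1 gmean (Phi b).
Proof.
have d1 := is_derive_normal_cdf b; have d2 := is_derive_normal_pdf01 _ b.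
rewrite /gmean; apply: is_derive_eq; rewrite /GRing.scale/=; ring.
Qed.

(* The bounded solution of f'(w) - w f(w) = max(b - w, 0) - gmean b: the numerator
   is the Gaussian integral of the right-hand side over ]-oo, w]. *)
Definition stein_fun (b w : R) : R :=
  (b * Phi (Num.min w b) + phi (Num.min w b) - gmean b * Phi w) / phi w.

(** Here and in [stein_funr], Mills' ratio is taken at an argument bounded above, w <= b or -w <=
    -b, so that the bounds above apply. *)
Lemma stein_funl (b w : R) : w <= b ->
  stein_fun b w = 1 + (b - gmean b) * (Phi w / phi w).
Proof.
move=> wb; rewrite /stein_fun min_l//; field.
by rewrite gt_eqF// normal_pdf01_gt0.
Qed.

Lemma stein_funr (b w : R) : b <= w ->
  stein_fun b w = gmean b * (Phi (- w) / phi (- w)).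
Proof.
move=> wb; rewrite /stein_fun min_r// normal_cdfN normal_pdf01N /gmean; field.
by rewrite gt_eqF// normal_pdf01_gt0.
Qed.

(** Stein's equation solved for the derivative: the equation then holds by definition, and its
    content lies in [is_derive_stein_fun]. *)
Definition stein_fun' (b w : R) : R :=
  w * stein_fun b w + Num.max (b - w) 0 - gmean b.

Lemma is_derive_stein_fun (b w : R) :
  is_derive w 1 (stein_fun b) (stein_fun' b w).
Proof.
have p0 := normal_pdf01_gt0 R w.
have dK (x : R) : is_derive x 1 (fun x => b * Phi x + phi x) ((b - x) * phi x).
  have d1 := is_derive_normal_cdf x; have d2 := is_derive_normal_pdf01 _ x.
  by apply: is_derive_eq; rewrite /GRing.scale/=; ring.
have Kb : is_derive b 1 (fun x => b * Phi x + phi x) 0.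
  by apply: is_derive_eq; rewrite subrr mul0r.
have d0 := @is_derive_stop _ (fun x => (b - x) * phi x) b w Kb (fun _ => dK w).
have d1 := is_derive_normal_cdf w; have d2 := is_derive_normal_pdf01 _ w.
have d3 : is_derive w 1 (fun w => (phi w)^-1) (w / phi w).
  apply: is_derive_eq; first by apply: is_deriveV; rewrite gt_eqF.
  by rewrite /GRing.scale/=; field; rewrite gt_eqF.
rewrite /stein_fun; apply: is_derive_eq.
rewrite /GRing.scale/= /stein_fun' /stein_fun.
have -> : (if w < b then (b - w) * phi w else 0) = Num.max (b - w) 0 * phi w.
  by case: ltP => wb; [rewrite max_l// subr_ge0 ltW|rewrite max_r ?mul0r// subr_le0].
by field; rewrite gt_eqF.
Qed.

Lemma stein_fun_bound (b : R) : exists C, forall w, `|stein_fun b w| <= C.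
Proof.
(* [B] dominates both b and -b, hence w left of b and -w right of b. *)
pose B := Num.max 1 `|b|.
have B1 : 1 <= B by rewrite le_max lexx.
have bB : `|b| <= B by rewrite le_max lexx orbT.
have /andP[b1 b2] : - B <= b <= B by rewrite -ler_norml.
set K := 1 + (phi B)^-1.
exists (1 + `|b - gmean b| * K + `|gmean b| * K) => w.
have K0 : 0 <= K by rewrite addr_ge0// invr_ge0 normal_pdf_ge0.
have [wb|/ltW wb] := leP w b.
  have /andP[m0 mK] := mills_bound _ _ (le_trans wb b2) B1.
  rewrite stein_funl//; apply: (le_trans (ler_normD _ _)).
  rewrite normr1 normrM (ger0_norm m0) -addrA lerD2l.
  by rewrite (le_trans (ler_wpM2l _ mK))// lerDl mulr_ge0.
have wB : - w <= B by lra.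
have /andP[m0 mK] := mills_bound _ _ wB B1.
rewrite stein_funr// normrM (ger0_norm m0).
by rewrite (le_trans (ler_wpM2l _ mK))// lerDr addr_ge0// mulr_ge0.
Qed.

(** [stein_fun'] has a hinge at [b], so its two parts are treated apart: max(b - w, 0) is
    1-Lipschitz, and w f(w), with f the solution, has the bounded derivative [D]. *)
Lemma stein_fun'_lip (b : R) : exists2 L, 0 <= L &
  forall v w, v < w -> `|stein_fun' b w - stein_fun' b v| <= L * (w - v).
Proof.
pose B := Num.max 1 `|b|.
have B1 : 1 <= B by rewrite le_max lexx.
have bB : `|b| <= B by rewrite le_max lexx orbT.
have /andP[b1 b2] : - B <= b <= B by rewrite -ler_norml.
set K := 1 + B + (1 + B ^+ 2) * (1 + (phi B)^-1).
have K0 : 0 <= K by apply: le_trans (mills2_bound _ _ (lexx B) B1).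
pose L := 1 + `|b - gmean b| * K + `|gmean b| * K.
have L0 : 0 <= L by rewrite !addr_ge0// mulr_ge0.
pose D w := stein_fun b w + w * stein_fun' b w.
have DL w : `|D w| <= L.
  have [wb|/ltW wb] := leP w b.
    have h := mills2_bound _ _ (le_trans wb b2) B1.
    rewrite /D /stein_fun' max_l ?subr_ge0// stein_funl//.
    set m := Phi w / phi w in h *.
    have -> : 1 + (b - gmean b) * m +
        w * (w * (1 + (b - gmean b) * m) + (b - w) - gmean b)
        = 1 + (b - gmean b) * (w + (1 + w ^+ 2) * m) by ring.
    apply: (le_trans (ler_normD _ _)).
    rewrite normr1 normrM /L -addrA lerD2l.
    by rewrite (le_trans (ler_wpM2l _ h))// lerDl mulr_ge0.
  have wB : - w <= B by lra.
  have h := mills2_bound _ _ wB B1.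
  rewrite /D /stein_fun' max_r ?subr_le0// stein_funr//.
  set m := Phi (- w) / phi (- w) in h *.
  have -> : gmean b * m + w * (w * (gmean b * m) + 0 - gmean b)
     = gmean b * (- w + (1 + (- w) ^+ 2) * m) by ring.
  by rewrite normrM (le_trans (ler_wpM2l _ h))// lerDr addr_ge0// mulr_ge0.
exists (L + 1); first by rewrite addr_ge0.
move=> v w vw.
have dD (x : R) : is_derive x 1 (fun x => x * stein_fun b x) (D x).
  have d := is_derive_stein_fun b x.
  by apply: is_derive_eq; rewrite /GRing.scale/= /D; ring.
have [|z _ zE] := @MVT R (fun x => x * stein_fun b x) D v w vw.
  apply: derivable_within_continuous => z _.
  by have := dD z.
have -> : stein_fun' b w - stein_fun' b v =
    (w * stein_fun b w - v * stein_fun b v) +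
    (Num.max (b - w) 0 - Num.max (b - v) 0) by rewrite /stein_fun'; ring.
rewrite mulrDl mul1r; apply: (le_trans (ler_normD _ _)); apply: lerD.
  by rewrite zE normrM (gtr0_norm (x := w - v)) ?subr_gt0// ler_wpM2r// subr_ge0 ltW.
have [] := leP (b - w) 0; have [] := leP (b - v) 0 => *;
  by rewrite ler_norml; apply/andP; split; lra.
Qed.

Lemma stein_fun_taylor (b : R) : exists L, forall w e, 0 < e ->
  `|stein_fun b (w + e) - stein_fun b w - e * stein_fun' b w| <= L * e ^+ 2.
Proof.
have [L L0 lipL] := stein_fun'_lip b; exists L => w e e0.
have we : w < w + e by rewrite ltrDl.
have [x _||z + ->] := @MVT R (stein_fun b) (stein_fun' b) w (w + e) we.
- exact: is_derive_stein_fun.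
- apply: derivable_within_continuous => z _.
  by have := is_derive_stein_fun b z.
rewrite in_itv/= => /andP[wz ze].
have -> : stein_fun' b z * (w + e - w) - e * stein_fun' b w
   = e * (stein_fun' b z - stein_fun' b w) by ring.
rewrite normrM gtr0_norm// expr2 mulrCA ler_pM2l//.
by rewrite (le_trans (lipL _ _ wz))// ler_wpM2l//; lra.
Qed.

End stein.

(** * Convergence of the distribution functions *)

Lemma normal_cdf_le (R : realType) (x y : R) : x <= y -> normal_cdf x <= normal_cdf y.
Proof.
move=> xy; rewrite -lee_fin !normal_cdfE le_measure ?inE//.
exact: subitvPr.
Qed.

Lemma gmean_incr_bounds (R : realType) (a b : R) : a < b ->
  normal_cdf a * (b - a) <= gmean b - gmean a <= normal_cdf b * (b - a).
Proof.
move=> ab; have [x _||x + ->] := @MVT R gmean normal_cdf a b ab.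
- exact: is_derive_gmean.
- apply: derivable_within_continuous => z _.
  by have := is_derive_gmean z.
rewrite in_itv/= => /andP[/ltW ax /ltW xb].
by rewrite !ler_wpM2r ?normal_cdf_le// subr_ge0 ltW.
Qed.

Definition qscale (R : realType) (n : nat) : R := Num.sqrt (2^-1 * ln n%:R).

Definition qstd (R : realType) (n k : nat) : R :=
  (k%:R - 2^-1 * ln n%:R) / qscale R n.

Definition hinge (R : realType) (b w : R) : R := Num.max (b - w) 0.

Lemma qscale_gt0 (R : realType) n : (1 < n)%N -> 0 < qscale R n.
Proof. by move=> n1; rewrite sqrtr_gt0 mulr_gt0 ?invr_gt0// ln_gt0// ltr1n. Qed.

Lemma qsum_hinge (R : realType) (b : R) : exists K, forall n, (1 < n)%N ->
  `|qsum R n (hinge R b \o qstd R n) - gmean b| <= K / qscale R n.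
Proof.
have [C fC] := stein_fun_bound b; have [L fL] := stein_fun_taylor b.
(* The 2 comes from [qsum_bsum], the hinge having increments at most 1/[qscale R n]; the rest comes
   from [bsum_normal_stein]. *)
exists (2 + (L + 3 * C)) => n n1; have s0 := qscale_gt0 R n n1.
have sm : 2^-1 * ln n%:R = qscale R n ^+ 2.
  by rewrite sqr_sqrtr// mulr_ge0 ?invr_ge0// ln_ge0// ler1n ltnW.
have hs k : `|(hinge R b \o qstd R n) k.+1 - (hinge R b \o qstd R n) k| <= (qscale R n)^-1.
  have -> : (hinge R b \o qstd R n) k.+1 = hinge R b (qstd R n k + (qscale R n)^-1).
    by rewrite /= /qstd -natr1; congr hinge; field; rewrite gt_eqF.
  rewrite /= /hinge; have : 0 < (qscale R n)^-1 by rewrite invr_gt0.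
  move: (qscale R n)^-1 => t t0.
  by have [] := leP (b - (qstd R n k + t)) 0; have [] := leP (b - qstd R n k) 0 => *;
    rewrite ler_norml; apply/andP; split; lra.
have := qsum_bsum R n _ _ hs.
have := bsum_normal_stein R n _ _ _ _ _ _ s0 sm (bmean_ln R n (ltnW n1)) fC fL.
rewrite (_ : (fun k : nat => _ - _) = fun k => (hinge R b \o qstd R n) k - gmean b); last first.
  by apply/funext => k; rewrite /stein_fun' /= /hinge /qstd; ring.
rewrite bsumB bsum_cst mulrDl.
move: (qsum _ _ _) (bsum _ _ _) => x y; rewrite !ler_norml.
by move=> /andP[? ?] /andP[? ?]; apply/andP; split; lra.
Qed.

Lemma qscale_ge (R : realType) (A : R) : \forall n \near \oo, A <= qscale R n.
Proof.
near=> n; apply: (le_trans (ler_norm _)); rewrite -sqrtr_sqr ler_wsqrtr//.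
rewrite -ler_pdivrMl ?invr_gt0// invrK -ler_expR lnK ?posrE.
  by near: n; exact: nbhs_infty_ger.
by rewrite ltr0n; near: n; exact: nbhs_infty_gt.
Unshelve. all: by end_near. Qed.

Definition qcdf (R : realType) (n : nat) (x : R) : R :=
  qsum R n (fun k => (qstd R n k <= x)%R%:R).

(** The quotient (hinge b - hinge a)/(b - a) is 1 up to a, 0 from b on and between 0 and 1
    elsewhere, so its expectation [Q] lies between the two values of [qcdf]. Its Gaussian
    counterpart lies between Phi(a) and Phi(b), and the two differ by at most e for large n. *)
Lemma qcdf_bounds (R : realType) (a b e : R) : a < b -> 0 < e ->
  \forall n \near \oo, qcdf R n a <= normal_cdf b + e /\ normal_cdf a - e <= qcdf R n b.
Proof.
move=> ab e0; have [Ka Ha] := qsum_hinge R a; have [Kb Hb] := qsum_hinge R b.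
have d0 : 0 < b - a by rewrite subr_gt0.
have /andP[gl gu] := gmean_incr_bounds R a b ab.
near=> n.
have n1 : (1 < n)%N by near: n; exact: nbhs_infty_gt.
have s0 := qscale_gt0 R n n1.
have : Ka / qscale R n + Kb / qscale R n <= e * (b - a).
  rewrite -mulrDl ler_pdivrMr// mulrC -ler_pdivrMr ?mulr_gt0//.
  by near: n; exact: qscale_ge.
have := Ha n n1; have := Hb n n1.
have := qsum_lin R n ((b - a)^-1) (- (b - a)^-1) (hinge R b \o qstd R n) (hinge R a \o qstd R n).
set Q := qsum R n (fun k => _ + _) => QE.
have l : qcdf R n a <= Q.
  apply: ler_qsum => k /=; rewrite mulNr -mulrBr mulrC ler_pdivlMr// /hinge.
  by have [] := leP (b - qstd R n k) 0; have [] := leP (a - qstd R n k) 0;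
    have [] := leP (qstd R n k) a; rewrite ?mulr1n ?mulr0n => *; lra.
have u : Q <= qcdf R n b.
  apply: ler_qsum => k /=; rewrite mulNr -mulrBr mulrC ler_pdivrMr// /hinge.
  by have [] := leP (b - qstd R n k) 0; have [] := leP (a - qstd R n k) 0;
    have [] := leP (qstd R n k) b; rewrite ?mulr1n ?mulr0n => *; lra.
have {}QE : Q * (b - a) = qsum R n (hinge R b \o qstd R n) - qsum R n (hinge R a \o qstd R n).
  by rewrite QE; field; rewrite gt_eqF.
rewrite !ler_norml => /andP[b1 b2] /andP[a1 a2] es.
split.
  by apply: (le_trans l); rewrite -(ler_pM2r d0) QE mulrDl; lra.
by apply: le_trans u; rewrite -(ler_pM2r d0) QE mulrBl; lra.
Unshelve. all: by end_near. Qed.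

Lemma cvg_qcdf (R : realType) (x : R) :
  qcdf R n x @[n --> \oo] --> normal_cdf x.
Proof.
have cPhi : {for x, continuous (@normal_cdf R)}.
  by apply/differentiable_continuous/derivable1_diffP; have := is_derive_normal_cdf x.
apply/cvgrPdist_le => e e0; have e2 : 0 < e / 2 by rewrite divr_gt0.
have /cvgrPdist_le /(_ _ e2) /nbhs_ballP[d /= d0 dP] := cPhi.
have d2 : 0 < d / 2 by rewrite divr_gt0.
have /ler_normlP[_ h1] : `|normal_cdf x - normal_cdf (x - d / 2)| <= e / 2.
  by apply: dP; rewrite /ball/= opprB addrCA subrr addr0 gtr0_norm//; lra.
have /ler_normlP[h2 _] : `|normal_cdf x - normal_cdf (x + d / 2)| <= e / 2.
  by apply: dP; rewrite /ball/= opprD addrA subrr sub0r normrN gtr0_norm//; lra.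
near=> n.
have [u _] : qcdf R n x <= normal_cdf (x + d / 2) + e / 2 /\
             normal_cdf x - e / 2 <= qcdf R n (x + d / 2).
  by near: n; apply: qcdf_bounds => //; lra.
have [_ l] : qcdf R n (x - d / 2) <= normal_cdf x + e / 2 /\
             normal_cdf (x - d / 2) - e / 2 <= qcdf R n x.
  by near: n; apply: qcdf_bounds => //; lra.
by rewrite ler_norml; apply/andP; split; lra.
Unshelve. all: by end_near. Qed.

(** * Transfer to the random variables *)

(** The masses at 0, ..., n already sum to 1 by [q_sum], so the complement of these atoms is null
    and any event splits along them. *)
Lemma probability_qsum (d : measure_display) (T : measurableType d)
    (R : realType) (P : probability T R) (X : {RV P >-> R}) (n : nat)
    (A : set R) :
  (forall k : nat, pmf X k%:R = q R n k) -> measurable A ->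
  P (X @^-1` A) = (qsum R n (fun k => \1_A k%:R))%:E.
Proof.
move=> X_law mA.
pose E (k : nat) := X @^-1` [set k%:R].
have mE k : measurable (E k) by exact: measurable_funPTI.
have PE k : P (E k) = (q R n k)%:E by rewrite -X_law fineK// fin_num_measure.
have mXA : measurable (X @^-1` A) by exact: measurable_funPTI.
have tE : trivIset setT E.
  by move=> i j _ _ [t []]; rewrite /E/= => -> /eqP; rewrite eqr_nat => /eqP.
pose U := \big[setU/set0]_(k < n.+1) E k.
have mU : measurable U by exact: bigsetU_measurable.
have PU : P U = 1%E.
  rewrite /U measure_bigsetU//.
  rewrite (eq_bigr (fun k : 'I_n.+1 => (q R n k)%:E)) => [|k _]; last exact: PE.
  by rewrite sumEFin q_sum.
have PCU : P (~` U) = 0%E by rewrite probability_setC// PU subee.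
rewrite -(setIT (X @^-1` A)) -(setvU U) setIUr measureU; last 3 first.
- by apply: measurableI => //; exact: measurableC.
- exact: measurableI.
- by rewrite setIACA setICl setI0.
rewrite [X in (X + _)%E](_ : _ = 0%E); last first.
  apply/eqP; rewrite eq_le measure_ge0 andbT -PCU le_measure ?inE//.
  + by apply: measurableI => //; exact: measurableC.
  + exact: measurableC.
rewrite add0e /U big_distrr/= (@measure_bigsetU _ _ _ P (fun k => X @^-1` A `&` E k))//; last 2 first.
- by move=> k; exact: measurableI.
- by apply: trivIset_setIl.
rewrite /qsum -sumEFin; apply: eq_bigr => k _; rewrite indicE.
have [kA|kA] := boolP (k%:R \in A).
  rewrite mulr1 -PE; congr (P _); apply/setIidPr => t /= ->.
  by rewrite inE in kA.
rewrite mulr0 (_ : _ `&` _ = set0) ?measure0//.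
apply/seteqP; split=> // t [/= + Ek]; rewrite Ek => At.
by move/negP : kA; apply; rewrite inE.
Qed.

Theorem proposition2 (R : realType) (d : nat -> measure_display)
    (T : forall n : nat, measurableType (d n))
    (P : forall n : nat, probability (T n) R)
    (X : forall n : nat, {RV (P n) >-> R})
    (X_law : forall n k : nat, pmf (X n) k%:R = q R n k) :
  cvg_in_distribution
    (fun n : nat => standardize (X n) (2^-1 * ln n%:R)
                      (Num.sqrt (2^-1 * ln n%:R)) : {RV (P n) >-> R})
    (normal_prob 0 1).
Proof.
move=> x _.
(* The equality covers n <= 1 too, where the scale vanishes: both sides contain the same
   quotient. *)
suff h n : cdf (standardize (X n) (2^-1 * ln n%:R) (Num.sqrt (2^-1 * ln n%:R))
    : {RV (P n) >-> R}) x = (qcdf R n x)%:E.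
  under eq_fun do rewrite h.
  have := @cvg_EFin _ _ \oo _ (fun n => (qcdf R n x)%:E) _ (nearW _ (fun=> isT)) (cvg_qcdf R x).
  by rewrite normal_cdfE => cvgF; exact: cvgF.
pose A := [set y : R | (y - 2^-1 * ln n%:R) / qscale R n <= x].
have -> : cdf (standardize (X n) (2^-1 * ln n%:R) (Num.sqrt (2^-1 * ln n%:R))
    : {RV (P n) >-> R}) x = P n (X n @^-1` A).
  by rewrite /cdf /distribution /pushforward; congr (P n _);
    apply/seteqP; split => t; rewrite /= in_itv.
rewrite (probability_qsum _ _ _ _ _ _ _ (X_law n)).
  by congr EFin; rewrite /qcdf; congr qsum; apply/funext => k;
    rewrite indicE/= mem_setE.
rewrite (_ : A = (fun y => (y - 2^-1 * ln n%:R) / qscale R n) @^-1` `]-oo, x]).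
  rewrite -[X in measurable X]setTI.
  apply: (_ : measurable_fun setT _) => //.
  by apply: measurable_funM => //; exact: measurable_funB.
by apply/seteqP; split => t; rewrite /= in_itv.
Qed.
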